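(* Let $C$ be a Cantor set with a regular ultrametric $d$, and suppose $(C,d)$ is $\zeta$-regular. For $f\in\mathcal{C}_{\mathrm{Lip}}(C)$ and a choice function $\tau\in\Upsilon(C)$ put $$\mu(f)=\lim_{s\downarrow s_0}\frac{\mathrm{Tr}\big(|D|^{-s}\pi_\tau(f)\big)}{\mathrm{Tr}\big(|D|^{-s}\big)}.$$ Then this limit is independent of the choice function $\tau$, and it defines a probability measure on $C$; that is, there is a Borel probability measure $\mu$ on $C$ with $\mu(f)=\int_C f\,d\mu$ for all $f\in\mathcal{C}_{\mathrm{Lip}}(C)$.
   Context: A Cantor set is a (nonempty) totally disconnected compact metrizable space without isolated points. A metric $d$ on $C$ is regular if it induces the topology of $C$, and it is an ultrametric if $d(x,y)\le\max\{d(x,z),d(z,y)\}$ for all $x,y,z$. Let $\mathcal{V}$ be the vertex set of the reduced weighted rooted tree (Michon tree) of $(C,d)$: the vertices correspond to the distinct subsets of $C$ of the form $\{y: d(x,y)<\epsilon\}$ ($x\in C$, $\epsilon>0$); the root is $C$; the children of a vertex are the maximal vertices strictly contained in it. For $v\in\mathcal V$, $[v]\subset C$ denotes the corresponding subset; it is clopen with $\mathrm{diam}[v]>0$, and $\mathcal V$ is countable. A choice function is a map $\tau:\mathcal V\to C\times C$, $\tau(v)=(\tau_+(v),\tau_-(v))$, with $\tau_\pm(v)\in[v]$ and $d(\tau_+(v),\tau_-(v))=\mathrm{diam}[v]$ for all $v$. $\Upsilon(C)$ is the set of choice functions. $\mathcal{C}_{\mathrm{Lip}}(C)$ is the algebra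 of complex-valued Lipschitz functions on $(C,d)$. On $\mathcal H=\ell^2(\mathcal V)\otimes\mathbb C^2$ let $(D\psi)(v)=(\mathrm{diam}[v])^{-1}\sigma_1\psi(v)$ with $\sigma_1=\begin{pmatrix}0&1\\1&0\end{pmatrix}$, and $(\pi_\tau(f)\psi)(v)=\mathrm{diag}\{f(\tau_+(v)),f(\tau_-(v))\}\psi(v)$. Thus $(|D|^{-s}\psi)(v)=(\mathrm{diam}[v])^s\psi(v)$. Let $s_0$ be the abscissa of convergence of $\zeta(s)=\mathrm{Tr}(|D|^{-s})=2\sum_{v\in\mathcal V}(\mathrm{diam}[v])^s$, i.e. the infimum of the real $s$ for which the series converges. $(C,d)$ is called $\zeta$-regular if $s_0$ is finite, if $\lim_{s\downarrow s_0}(s-s_0)\mathrm{Tr}(|D|^{-s})$ exists and is $>0$, and if for every $f\in\mathcal{C}_{\mathrm{Lip}}(C)$ and every $\tau\in\Upsilon(C)$ the limit $\lim_{s\downarrow s_0}\mathrm{Tr}(|D|^{-s}\pi_\tau(f))/\mathrm{Tr}(|D|^{-s})$ exists. *)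

(* Defs.v *)
(* MathComp / MathComp-Analysis, over an arbitrary [R : realType]; complex
   numbers are [R[i]] and [R[i]^o] carries their norm topology. *)
From HB Require Import structures.
From mathcomp Require Import all_boot all_order all_algebra.
From mathcomp Require Import complex.
From mathcomp Require Import all_classical all_reals all_analysis.

Set Implicit Arguments.
Unset Strict Implicit.
Unset Printing Implicit Defensive.

Import Order.TTheory GRing.Theory Num.Theory.
Import numFieldNormedType.Exports.

Local Open Scope classical_set_scope.
Local Open Scope ring_scope.
Local Open Scope complex_scope.

Section metric.
Context {R : realType} {C : topologicalType}.
Implicit Types d : C -> C -> R.

Definition is_metric d :=
  [/\ forall x y, 0 <= d x y,
      forall x y, d x y = 0 <-> x = y,
      forall x y, d x y = d y x &
      forall x y z, d x z <= d x y + d y z].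

Definition is_ultrametric d :=
  forall x y z, d x y <= Num.max (d x z) (d z y).

Definition open_ball d (x : C) (e : R) : set C := [set y | d x y < e].

Definition regular_metric d :=
  is_metric d /\
  forall x : C, nbhs x = filter_from [set e : R | 0 < e] (open_ball d x).

Definition diam d (A : set C) : R := sup [set d x y | x in A & y in A].

Definition Lipschitz d (f : C -> R[i]) :=
  exists k : R, forall x y, `|f x - f y| <= (k * d x y)%:C.

End metric.

Definition is_cantor_set (R : realType) (C : topologicalType) :=
  [/\ [set: C] !=set0,
      totally_disconnected [set: C],
      compact [set: C],
      exists d : C -> C -> R, regular_metric d &
      isolated [set: C] = set0].

Section michon_tree.
Context {R : realType} {C : topologicalType} (d : C -> C -> R).

(* A vertex [v] is identified with the subset [[v]] of [C]; distinct pairs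
   (x, e) giving the same ball give the same vertex. *)
Definition vertices : set (set C) :=
  [set A | exists x e, 0 < e /\ A = open_ball d x e].

Definition vdiam (v : vertices) : R := diam d (val v).

Definition is_choice_function (tau : vertices -> C * C) :=
  forall v, [/\ val v (tau v).1, val v (tau v).2 &
                d (tau v).1 (tau v).2 = vdiam v].

End michon_tree.

Section spectral_triple.
Context {R : realType} {C : topologicalType} (d : C -> C -> R).

(* l^2(V) (x) C^2 is the space of square-summable spinors. The operators below
   act pointwise in [v], so they are given by their formulas on all spinors. *)
Definition spinor := vertices d -> 'cV[R[i]]_2.

Definition sigma1 : 'M[R[i]]_2 := \matrix_(i, j) (i != j)%:R.

Definition Dirac (psi : spinor) : spinor :=
  fun v => ((vdiam v)^-1)%:C *: (sigma1 *m psi v).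

(* |D|^-s, the operator of multiplication by (diam [v])^s *)
Definition absDirac_powN (s : R) (psi : spinor) : spinor :=
  fun v => (vdiam v `^ s)%:C *: psi v.

(* |D| is the nonnegative multiplication operator whose square is D^2. *)
Lemma Dirac_sqr (psi : spinor) : (forall x y, 0 <= d x y) ->
  Dirac (Dirac psi) = absDirac_powN (- 2) psi.
Proof.
move=> d0; apply/funext => v; rewrite /Dirac /absDirac_powN.
have v0 : 0 <= vdiam v.
  rewrite /vdiam /diam; have [sA|/sup_out ->//] :=
    pselect (has_sup [set d x y | x in val v & y in val v]).
  have [[_ [x vx [y vy _]]] ubA] := sA.
  apply: le_trans (d0 x y) _; apply: ub_le_sup => //.
  by exists x => //; exists y.
have sig2 : sigma1 *m sigma1 = 1%:M.
  apply/matrixP => i j; rewrite !mxE !big_ord_recl big_ord0 !mxE.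
  by case: i => -[|[|[]]]// ?; case: j => -[|[|[]]]// ?;
    rewrite /= ?mulr0 ?mul0r ?mulr1 ?addr0 ?add0r.
rewrite -scalemxAr scalerA mulmxA sig2 mul1mx; congr (_ *: _).
by rewrite -rmorphM /= powRN powR_mulrn// -expr2 exprVn.
Qed.

Definition pi_rep (tau : vertices d -> C * C) (f : C -> R[i])
    (psi : spinor) : spinor :=
  fun v => diag_mx (\row_i (if i == 0 then f (tau v).1 else f (tau v).2))
           *m psi v.

Definition basis_vec (b : vertices d * 'I_2) : spinor :=
  fun v => if v == b.1 then delta_mx b.2 0 else 0.

(* <e_b, T e_b> for the canonical orthonormal basis *)
Definition diag_coef (T : spinor -> spinor) (b : vertices d * 'I_2) : R[i] :=
  T (basis_vec b) b.1 b.2 0.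

Definition diag_summable (T : spinor -> spinor) :=
  summable [set: vertices d * 'I_2]
    (fun b => (complex.Re `|diag_coef T b|)%:E).

(* Unordered sums, meant for absolutely summable families. *)
Definition rsum (I : choiceType) (u : I -> R) : R :=
  fine (\esum_(i in [set: I]) (EFin \o u)^\+ i -
        \esum_(i in [set: I]) (EFin \o u)^\- i).

Definition csum (I : choiceType) (u : I -> R[i]) : R[i] :=
  rsum (fun i => complex.Re (u i)) +i* rsum (fun i => complex.Im (u i)).

(* Meant for [diag_summable T]; only diagonal operators are traced here, for
   which this is the trace-class condition. *)
Definition trace (T : spinor -> spinor) : R[i] := csum (diag_coef T).

Lemma diag_coef_absDirac_powN (s : R) b :
  diag_coef (absDirac_powN s) b = (vdiam b.1 `^ s)%:C.
Proof.
by rewrite /diag_coef /absDirac_powN /basis_vec eqxx !mxE !eqxx mulr1.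
Qed.

Lemma diag_coef_absDirac_powN_pi_rep (s : R) tau f b :
  diag_coef (absDirac_powN s \o pi_rep tau f) b =
  (vdiam b.1 `^ s)%:C *
    (if b.2 == 0 then f (tau b.1).1 else f (tau b.1).2).
Proof.
rewrite /diag_coef /absDirac_powN /pi_rep /basis_vec /= eqxx mul_diag_mx.
by rewrite !mxE !eqxx mulr1.
Qed.

Lemma esum_diam_pow (s : R) :
  (\esum_(b in [set: vertices d * 'I_2]) (vdiam b.1 `^ s)%:E =
   2%:E * \esum_(v in [set: vertices d]) (vdiam v `^ s)%:E)%E.
Proof.
have p0 v : (0 <= (vdiam v `^ s)%:E :> \bar R)%E by rewrite lee_fin powR_ge0.
rewrite (_ : setT = [set: vertices d] `*`` (fun=> [set: 'I_2])); last first.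
  by apply/seteqP; split.
rewrite -(esum_esum (a := fun v _ => (vdiam v `^ s)%:E))//.
rewrite mule_natl mule2n -esumD//; apply: eq_esum => v _.
have -> : [set: 'I_2] = [set` enum 'I_2].
  by apply/seteqP; split => // i _ /=; rewrite mem_enum.
rewrite esum_fset// -fsbig_seq ?enum_uniq// big_enum/=.
by rewrite !big_ord_recl big_ord0 adde0.
Qed.

Lemma diag_summable_absDirac_powN (s : R) :
  diag_summable (absDirac_powN s) =
  (2%:E * (\esum_(v in [set: vertices d]) (vdiam v `^ s)%:E) < +oo)%E.
Proof.
rewrite /diag_summable /summable -esum_diam_pow.
rewrite (eq_esum (b := fun b => (vdiam b.1 `^ s)%:E))// => b _.
rewrite diag_coef_absDirac_powN.
by rewrite ger0_norm ?lecR ?powR_ge0//= ger0_norm ?powR_ge0.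
Qed.

(* Tr |D|^-s = 2 \sum_v (diam [v])^s *)
Lemma trace_absDirac_powN (s : R) :
  trace (absDirac_powN s) =
  (fine (2%:E * \esum_(v in [set: vertices d]) (vdiam v `^ s)%:E))%:C.
Proof.
have rsumE (u : vertices d * 'I_2 -> R) : (forall b, 0 <= u b) ->
    rsum u = fine (\esum_(b in setT) (u b)%:E).
  move=> u0; rewrite /rsum [X in (_ - X)%E]esum1 ?sube0.
    by congr fine; apply: eq_esum => b _; rewrite funeposE max_l// lee_fin.
  by move=> b _; rewrite funenegE max_r// lee_fin oppr_le0.
rewrite /trace /csum -esum_diam_pow (_ : diag_coef _ =
  fun b => (vdiam b.1 `^ s)%:C); last first.
  by apply/funext => b; rewrite diag_coef_absDirac_powN.
rewrite !rsumE//= => [|b]; last exact: powR_ge0.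
by rewrite [X in _ +i* fine X]esum1.
Qed.

(* s_0, the infimum of the real [s] for which the series converges; [s0] is its
   real value when it is finite. *)
Definition abscissa : \bar R :=
  ereal_inf [set s%:E | s in [set s : R | diag_summable (absDirac_powN s)]].

Definition s0 : R := fine abscissa.

Definition zeta_ratio (tau : vertices d -> C * C) (f : C -> R[i]) (s : R) :
    R[i]^o :=
  trace (absDirac_powN s \o pi_rep tau f) / trace (absDirac_powN s).

Definition zeta_mean (tau : vertices d -> C * C) (f : C -> R[i]) : R[i]^o :=
  lim (zeta_ratio tau f s @[s --> s0^'+]).

(* [0 < l] in [R[i]] entails that [l] is real. *)
Definition zeta_regular :=
  [/\ abscissa \is a fin_num,
      exists2 l : R[i]^o, 0 < l &
        ((s - s0)%:C * trace (absDirac_powN s) : R[i]^o) @[s --> s0^'+] --> l &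
      forall (f : C -> R[i]) (tau : vertices d -> C * C),
        Lipschitz d f -> is_choice_function tau ->
        cvg (zeta_ratio tau f s @[s --> s0^'+])].

End spectral_triple.

(* The library's sigma-algebras live on pointed types, so [C] must be a
   [ptopologicalType] here; this is no restriction for nonempty [C]. *)
Notation borel C := (g_sigma_algebraType (@open C)).

Section complex_integral.
Context {disp : measure_display} {T : measurableType disp} {R : realType}.
Variable mu : {measure set T -> \bar R}.

Definition cintegrable (f : T -> R[i]) :=
  mu.-integrable setT (EFin \o (fun x => complex.Re (f x))) /\
  mu.-integrable setT (EFin \o (fun x => complex.Im (f x))).

Definition cintegral (f : T -> R[i]) : R[i] :=
  (\int[mu]_x complex.Re (f x)) +i* (\int[mu]_x complex.Im (f x)).

End complex_integral.

(* Main.v *)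
Require Import Defs.
From HB Require Import structures.
From mathcomp Require Import all_boot all_order all_algebra.
From mathcomp Require Import complex finmap.
From mathcomp Require Import all_classical all_reals all_analysis.
From mathcomp Require Import measurable_realfun ring lra.
Set Implicit Arguments.
Unset Strict Implicit.
Unset Printing Implicit Defensive.
Import Order.TTheory GRing.Theory Num.Theory.
Import numFieldNormedType.Exports.
Local Open Scope classical_set_scope.
Local Open Scope ring_scope.
Local Open Scope complex_scope.

(** Write [w_s(v)] for the diameter of the vertex [v] raised to the power [s],
    and [zeta(s)] for twice the sum of the [w_s(v)].

    Independence of the choice function. The points chosen by two choice
    functions in a vertex [v] lie in the same ball, hence are at distance at
    most the diameter of [v]. For a [k]-Lipschitz [u] the two weighted sums of
    values of [u] therefore differ by at most [k] times the sum of the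
    [w_(s+1)(v)]. As [s] decreases to [s0] this sum stays bounded, because
    [s + 1] stays above some [t > s0] at which the series converges
    ([zeta_sum_choice]); the positive residue forces [zeta(s)] to infinity
    ([cvg_zetaV]), so the quotients have the same limit ([real_mean_choice]).

    The measure. For a fixed choice function, the limit of the quotients is a
    linear functional on real Lipschitz functions which is bounded by the
    supremum norm and maps 1 to 1 ([real_mean_is_mean]); it remains to represent
    such functionals by probability measures ([mean_representation]). Call a set
    uniformly clopen when its indicator does not change at some scale [e]. These
    sets form an algebra, and a uniformly clopen set has a Lipschitz indicator,
    so the functional restricts to a finitely additive function on this algebra.
    It is countably additive there for free: a clopen disjoint union of clopen
    sets has only finitely many nonempty terms, by compactness. The
    Caratheodory extension yields a measure on the sigma-algebra generated by
    the algebra, and this contains the open sets because the metric is an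
    ultrametric ([borel_clopen]). Finally, both the functional and the integral
    are determined by their values on these indicators: on balls of radius [e],
    which partition the space into finitely many pieces, a Lipschitz function
    is constant up to a multiple of [e] ([mean_unique]). *)

(** * Uniformly clopen sets and means of Lipschitz functions *)

Section means.
Context {R : realType} {C : ptopologicalType} (d : C -> C -> R).
Implicit Types (A B : set C) (u v : C -> R) (L : (C -> R) -> R).

(** Requiring one scale [e] for all points makes these sets an algebra without
    any appeal to compactness, and makes their indicators Lipschitz. *)
Definition uniformly_clopen A :=
  exists2 e : R, 0 < e & forall x y, d x y < e -> (A x <-> A y).

Definition lipschitz_fun u := exists k : R, forall x y, `|u x - u y| <= k * d x y.

Definition is_mean L :=
  [/\ forall u v, lipschitz_fun u -> lipschitz_fun v -> L (u \+ v) = L u + L v,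
      forall (a : R) u, lipschitz_fun u -> L (a \*o u) = a * L u,
      forall u (M : R), lipschitz_fun u -> (forall x, `|u x| <= M) ->
        `|L u| <= M &
      L (cst 1) = 1].

Hypothesis regd : regular_metric d.

Lemma dist_ge0 x y : 0 <= d x y.
Proof. by have [[]] := regd. Qed.
#[local] Hint Resolve dist_ge0 : core.

Lemma uniformly_clopen0 : uniformly_clopen set0.
Proof. by exists 1. Qed.

Lemma uniformly_clopenT : uniformly_clopen setT.
Proof. by exists 1. Qed.

Lemma uniformly_clopenU A B : uniformly_clopen A -> uniformly_clopen B ->
  uniformly_clopen (A `|` B).
Proof.
move=> [e e0 eA] [e' e'0 eB]; exists (Num.min e e'); first by rewrite lt_min e0.
by move=> x y; rewrite lt_min => /andP[/eA Axy /eB Bxy]; rewrite /setU/= Axy Bxy.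
Qed.

Lemma uniformly_clopenC A : uniformly_clopen A -> uniformly_clopen (~` A).
Proof.
by move=> [e e0 eA]; exists e => // x y /eA Axy; rewrite /setC/= Axy.
Qed.

Lemma lipschitz_ge0 u : lipschitz_fun u ->
  exists2 k : R, 0 <= k & forall x y, `|u x - u y| <= k * d x y.
Proof.
move=> [k uk]; exists `|k| => // x y; apply: le_trans (uk x y) _.
by rewrite ler_wpM2r ?ler_norm.
Qed.

Lemma lipschitz_cst (a : R) : lipschitz_fun (cst a).
Proof. by exists 0 => x y; rewrite subrr normr0 mul0r. Qed.

Lemma lipschitzD u v :
  lipschitz_fun u -> lipschitz_fun v -> lipschitz_fun (u \+ v).
Proof.
move=> [k uk] [l vl]; exists (k + l) => x y /=.
by rewrite opprD addrACA mulrDl (le_trans (ler_normD _ _)) ?lerD.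
Qed.

Lemma lipschitzZ (a : R) u : lipschitz_fun u -> lipschitz_fun (a \*o u).
Proof.
move=> [k uk]; exists (`|a| * k) => x y /=.
by rewrite -mulrBr normrM -mulrA ler_wpM2l.
Qed.

(** The indicator takes equal values at points closer than [e], so [1 / e] is a
    Lipschitz constant. *)
Lemma lipschitz_indic A : uniformly_clopen A -> lipschitz_fun (\1_A).
Proof.
move=> [e e0 eA]; exists e^-1 => x y.
have [/eA Axy|exy] := ltP (d x y) e.
  rewrite !indicE (_ : (x \in A) = (y \in A)); first last.
    by apply/idP/idP; rewrite !inE => /Axy.
  by rewrite subrr normr0 mulr_ge0// invr_ge0 ltW.
apply: (@le_trans _ _ 1); last by rewrite mulrC ler_pdivlMr ?mul1r.
by rewrite !indicE; do 2 case: (_ \in _);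
  rewrite ?subrr ?subr0 ?sub0r ?normrN ?normr0 ?normr1.
Qed.

Lemma lipschitz_sum (I : Type) (s : seq I) (F : I -> C -> R) :
  (forall i, lipschitz_fun (F i)) -> lipschitz_fun (fun x => \sum_(i <- s) F i x).
Proof.
move=> lipF; elim: s => [|i s ihs].
  by under eq_fun do rewrite big_nil; exact: lipschitz_cst.
under eq_fun do rewrite big_cons; exact: lipschitzD.
Qed.

Lemma mean_sum L (I : Type) (s : seq I) (F : I -> C -> R) : is_mean L ->
  (forall i, lipschitz_fun (F i)) ->
  L (fun x => \sum_(i <- s) F i x) = \sum_(i <- s) L (F i).
Proof.
move=> [LD LZ _ _] lipF; elim: s => [|i s ihs].
  rewrite big_nil (_ : (fun=> _) = 0 \*o cst 0) ?LZ ?mul0r//.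
    exact: lipschitz_cst.
  by apply/funext => x; rewrite big_nil/= mul0r.
rewrite big_cons -ihs -LD//; last exact: lipschitz_sum.
by congr L; apply/funext => x; rewrite big_cons.
Qed.

Hypothesis ultrad : is_ultrametric d.
Hypothesis compactC : compact [set: C].

Lemma dxx x : d x x = 0.
Proof. by have [[_ d0 _ _] _] := regd; exact/d0. Qed.

Lemma dC x y : d x y = d y x.
Proof. by have [[]] := regd. Qed.

Lemma nbhs_open_ball x (e : R) : 0 < e -> nbhs x (open_ball d x e).
Proof. by move=> e0; have [_ ->] := regd; exists e. Qed.

Lemma open_ball_center x (e : R) : 0 < e -> open_ball d x e x.
Proof. by rewrite /open_ball/= dxx. Qed.

(** In an ultrametric every point of a ball is a center of it. *)
Lemma open_ball_eq x y (e : R) : d x y < e -> open_ball d x e = open_ball d y e.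
Proof.
have sub x' y' : d x' y' < e -> open_ball d x' e `<=` open_ball d y' e.
  move=> xye z xze; rewrite /open_ball/=.
  by rewrite (le_lt_trans (ultrad _ _ x'))// gt_max xze dC xye.
by move=> xye; apply/seteqP; split; apply: sub; rewrite // dC.
Qed.

Lemma uniformly_clopen_open A : uniformly_clopen A -> open A.
Proof.
move=> [e e0 eA]; rewrite openE => x Ax; rewrite /interior.
apply: filterS (nbhs_open_ball x e0) => y xye.
exact/(eA _ _ xye).
Qed.

Lemma uniformly_clopen_compact A : uniformly_clopen A -> compact A.
Proof.
move=> cA; apply: (subclosed_compact _ compactC) => //.
by rewrite -openC; exact/uniformly_clopen_open/uniformly_clopenC.
Qed.

Lemma ball_cover (e : R) : 0 < e ->
  exists D : {fset C}, forall x, exists2 i, i \in D & open_ball d i e x.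
Proof.
move=> e0; have := compactC; rewrite compact_cover.
move=> /(_ C setT (fun i => open_ball d i e)) [].
- move=> i _; apply: uniformly_clopen_open; exists e => // x y xye.
  rewrite /open_ball/= [d i x]dC [d i y]dC.
  by have := open_ball_eq xye; move=> /seteqP[/(_ i) + /(_ i)].
- by move=> x _; exists x => //; exact: open_ball_center.
by move=> D _ CD; exists D => x; have [i Di xi] := CD x I; exists i.
Qed.

Lemma bounded_dist : exists2 M : R, 0 <= M & forall x y, d x y <= M.
Proof.
have [D CD] := ball_cover ltr01.
pose M := \sum_(i <- D) \sum_(j <- D) d i j.
have M0 : 0 <= M by rewrite sumr_ge0// => i _; rewrite sumr_ge0.
exists (1 + M); first by rewrite addr_ge0.
move=> x y; have [i iD xi] := CD x; have [j jD yj] := CD y.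
have ijM : d i j <= M.
  rewrite /M (big_rem i)//= (big_rem j)//= -addrA lerDl addr_ge0 ?sumr_ge0//.
  by move=> k _; rewrite sumr_ge0.
apply: le_trans (ultrad _ _ i) _; rewrite ge_max.
rewrite dC (le_trans (ltW xi)) ?lerDl//=.
apply: le_trans (ultrad _ _ j) _; rewrite ge_max.
by rewrite (le_trans ijM) ?lerDr//= (le_trans (ltW yj)) ?lerDl.
Qed.

Lemma lipschitz_bounded u : lipschitz_fun u -> exists M : R, forall x, `|u x| <= M.
Proof.
move=> /lipschitz_ge0[k k0 uk]; have [M M0 dM] := bounded_dist.
exists (`|u point| + k * M) => x.
rewrite -[u x](subrK (u point)) addrC (le_trans (ler_normD _ _))// lerD2l.
by apply: le_trans (uk _ _) _; rewrite ler_wpM2l.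
Qed.

(** A point chosen from the ball as a set, so that all points of the ball choose
    the same one. *)
Definition ball_center (e : R) (x : C) : C := get (open_ball d x e).

Lemma ball_center_near (e : R) x : 0 < e -> d x (ball_center e x) < e.
Proof. by move=> e0; exact: (getI (open_ball_center x e0)). Qed.

Lemma finite_ball_center (e : R) : 0 < e -> finite_set (range (ball_center e)).
Proof.
move=> e0; have [D CD] := ball_cover e0.
apply: (@sub_finite_set _ _ (ball_center e @` [set` D])).
  move=> _ [x _ <-]; have [i iD xi] := CD x; exists i => //.
  by rewrite /ball_center (open_ball_eq xi).
exact/finite_image/finite_fset.
Qed.

(** Moving each point to the chosen center of its [e]-ball turns [u] into a step
    function [g] over finitely many uniformly clopen sets, at distance at most
    [e k] from [u]. The means agree on [g], hence differ by at most [2 e k] on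
    [u], for every [e]. *)
Lemma mean_unique L L' : is_mean L -> is_mean L' ->
  (forall A, uniformly_clopen A -> L (\1_A) = L' (\1_A)) ->
  forall u, lipschitz_fun u -> L u = L' u.
Proof.
move=> mL mL' LL' u lipu; have [k k0 uk] := lipschitz_ge0 lipu.
suff H (e : R) : 0 < e -> `|L u - L' u| <= e * (2 * k).
  apply/eqP; rewrite -subr_eq0 -normr_le0; apply/ler_addgt0Pr => e e0.
  rewrite add0r; apply: le_trans (H (e / (2 * k + 1)) _) _.
    by rewrite divr_gt0// ltr_wpDl// mulr_ge0.
  rewrite -mulrA ler_piMr ?(ltW e0)// mulrC ler_pdivrMr ?mul1r ?lerDl//.
  by rewrite ltr_wpDl// mulr_ge0.
move=> e0; pose g := u \o ball_center e.
have fing : finite_set (range g).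
  rewrite -(image_comp (ball_center e) u); apply: finite_image.
  exact: finite_ball_center.
have clopeng y : uniformly_clopen (g @^-1` [set y]).
  exists e => // x x' xx'.
  by rewrite /preimage/= /g/= /ball_center (open_ball_eq xx').
pose F := fun (y : R) => y \*o \1_(g @^-1` [set y]) : C -> R.
have lipF y : lipschitz_fun (F y) by exact/lipschitzZ/lipschitz_indic.
have gE : g = fun x => \sum_(y <- fset_set (range g)) F y x.
  pose gfimfun := HB.pack_for {fimfun C >-> R} g (FiniteImage.Build _ _ g fing).
  apply/funext => x; rewrite -[g x]/(gfimfun x) [LHS]fimfunE.
  by rewrite fsbig_finite.
have lipg : lipschitz_fun g by rewrite gE; exact: lipschitz_sum.
have Lg : L g = L' g.
  rewrite gE !mean_sum//; apply: eq_bigr => y _; rewrite /F.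
  have lip1 := lipschitz_indic (clopeng y).
  by case: mL => _ -> // _ _; case: mL' => _ -> // _ _; rewrite LL'.
have lipN : lipschitz_fun (-1 \*o g) by exact: lipschitzZ.
have near x : `|(u \+ -1 \*o g) x| <= e * k.
  rewrite /= mulN1r (le_trans (uk _ _))//.
  by rewrite mulrC ler_wpM2r//; exact/ltW/ball_center_near.
have err L0 : is_mean L0 -> `|L0 u - L0 g| <= e * k.
  move=> [L0D L0Z L0M _]; rewrite -[- L0 g]mulN1r -L0Z// -L0D//.
  by apply: L0M => //; exact: lipschitzD.
rewrite (_ : L u - L' u = (L u - L g) - (L' u - L' g)); last first.
  by rewrite Lg opprB addrA subrK.
rewrite mulrCA mulr_natl mulr2n (le_trans (ler_normB _ _))// lerD//; exact: err.
Qed.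

End means.

(** * Representation of means by probability measures *)

(** A copy of [C] on which the measurable sets are the uniformly clopen ones. *)
Definition clopen_space (R : realType) (C : ptopologicalType) (d : C -> C -> R)
  : Type := C.

Section clopen_algebra.
Context (R : realType) (C : ptopologicalType) (d : C -> C -> R).

HB.instance Definition _ := Pointed.on (clopen_space d).
HB.instance Definition _ := @isAlgebraOfSets.Build default_measure_display
  (clopen_space d) (uniformly_clopen d) (uniformly_clopen0 d)
  (@uniformly_clopenU _ _ d) (@uniformly_clopenC _ _ d).

End clopen_algebra.

Section representation.
Context (R : realType) (C : ptopologicalType) (d : C -> C -> R).
Hypothesis regd : regular_metric d.
Hypothesis ultrad : is_ultrametric d.
Hypothesis compactC : compact [set: C].

Section content.
Context (L : (C -> R) -> R) (meanL : is_mean d L).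

(** On uniformly clopen sets the absolute value changes nothing
    ([mean_contentE]); for other sets nothing is known of [L (\1_A)], and it
    keeps the set function nonnegative. *)
Definition mean_content (A : set (clopen_space d)) : \bar R := `|L (\1_A)|%:E.

(** Boundedness implies positivity: [1 - 1_A] is bounded by 1, so
    [1 - L (1_A) <= 1]. *)
Lemma mean_indic_ge0 A : uniformly_clopen d A -> 0 <= L (\1_A).
Proof.
move=> cA; have lipA := lipschitz_indic regd cA.
have [LD LZ Lle L1] := meanL.
have : `|L (cst 1 \+ -1 \*o \1_A)| <= 1.
  apply: Lle => [|x]; first exact/lipschitzD/lipschitzZ/lipA/lipschitz_cst.
  rewrite /= indicE; case: (_ \in _);
    by rewrite ?mulr1 ?mulr0 ?subrr ?addr0 ?normr0 ?normr1.
rewrite LD ?LZ ?L1//; [|exact: lipschitz_cst|exact: lipschitzZ].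
by rewrite mulN1r ler_norml => /andP[_]; rewrite gerBl.
Qed.

Lemma mean_contentE A : uniformly_clopen d A -> mean_content A = (L (\1_A))%:E.
Proof. by move=> cA; rewrite /mean_content ger0_norm ?mean_indic_ge0. Qed.

Let mean_content0 : mean_content set0 = 0%E.
Proof.
rewrite /mean_content indic0; have [_ LZ _ _] := meanL.
rewrite (_ : cst 0 = 0 \*o cst 0) ?LZ ?mul0r ?normr0//; first exact: lipschitz_cst.
by apply/funext => x /=; rewrite mul0r.
Qed.

Let mean_content_ge0 A : (0 <= mean_content A)%E.
Proof. by rewrite lee_fin. Qed.

Let mean_contentU A B : uniformly_clopen d A -> uniformly_clopen d B ->
  A `&` B = set0 -> mean_content (A `|` B) = (mean_content A + mean_content B)%E.
Proof.
move=> cA cB AB0; rewrite !mean_contentE//; last exact: uniformly_clopenU.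
have [LD _ _ _] := meanL.
rewrite -EFinD -LD; [|exact: lipschitz_indic|exact: lipschitz_indic].
congr (L _)%:E; apply/funext => x; rewrite /= !indicE in_setU.
have /negbTE : x \notin A `&` B by rewrite AB0 in_set0.
by rewrite in_setI; do 2 case: (_ \in _); rewrite ?addr0 ?add0r.
Qed.

Let mean_content_bigU (F : (set C)^nat) n :
  (forall i, uniformly_clopen d (F i)) -> trivIset setT F ->
  (\sum_(i < n) mean_content (F i) =
   mean_content (\big[setU/set0]_(i < n) F i))%E.
Proof.
move=> cF tF; elim: n => [|n ihn]; first by rewrite !big_ord0 mean_content0.
rewrite !big_ord_recr/= mean_contentU ?ihn//.
  elim/big_ind : _ => [|A B|i _]; last exact: cF.
    exact: uniformly_clopen0.
  exact: uniformly_clopenU.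
rewrite -subset0 -bigcup_mkord => x [[i /= ltin Fix] Fnx].
by have ein := tF i n I I (ex_intro _ x (conj Fix Fnx)); rewrite ein ltnn in ltin.
Qed.

(** A clopen union of clopen sets is compact, hence equal to a finite partial
    union: the partial sums are eventually constant. *)
Let mean_content_sigma_additive : semi_sigma_additive mean_content.
Proof.
move=> F cF tF cUF.
have [n nF] : exists n, \bigcup_k F k `<=` \big[setU/set0]_(k < n) F k.
  have := uniformly_clopen_compact regd compactC cUF.
  rewrite compact_cover => /(_ nat setT F)[].
  - by move=> i _; exact: (uniformly_clopen_open regd (cF i)).
  - exact: subset_refl.
  move=> D _ UFD; exists (\max_(i <- D) i).+1 => x /UFD[i iD Fix].
  by apply: bigsetU_sup Fix; rewrite ltnS; exact: leq_bigmax_seq.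
apply: cvg_near_cst; exists n => // m /= nm.
rewrite big_mkord mean_content_bigU//; congr mean_content.
apply/seteqP; split; first exact: bigsetU_bigcup.
by apply: (subset_trans nF); exact: subset_bigsetU.
Qed.

Lemma mean_measure : exists m : {measure set (clopen_space d) -> \bar R},
  forall A, uniformly_clopen d A -> m A = (L (\1_A))%:E.
Proof.
pose mM := isMeasure.Build _ _ _ mean_content
  mean_content0 mean_content_ge0 mean_content_sigma_additive.
pose m : {measure set (clopen_space d) -> \bar R} := HB.pack mean_content mM.
by exists m => A cA; exact: mean_contentE.
Qed.

End content.

(** An open set is the countable union of the sets of points whose [1/n]-ball
    it contains; these are uniformly clopen since, in an ultrametric, points
    closer than [1/n] have the same [1/n]-ball. *)
Lemma borel_clopen : <<s @open C >> `<=` <<s uniformly_clopen d >>.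
Proof.
apply: smallest_sub; first exact: smallest_sigma_algebra.
move=> U oU.
pose V n : set C := [set x | open_ball d x n.+1%:R^-1 `<=` U].
have -> : U = \bigcup_n V n.
  apply/seteqP; split=> [x Ux|x [n _]]; last first.
    by apply; apply: (open_ball_center regd); rewrite invr_gt0.
  have : nbhs x U by exact: open_nbhs_nbhs.
  have [_ ->] := regd; case=> e /= e0 xeU.
  have [n ne] := ltr_add_invr (y := 0) (x := e) e0.
  rewrite add0r in ne; exists n => // y xy; apply: xeU.
  exact: lt_trans xy ne.
apply: sigma_algebra_bigcup => n; apply: sub_sigma_algebra.
exists n.+1%:R^-1; first by rewrite invr_gt0.
by move=> x y xy; rewrite /V/= (open_ball_eq regd ultrad xy).
Qed.

Lemma lipschitz_measurable (u : borel C -> R) : lipschitz_fun d u ->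
  measurable_fun setT u.
Proof.
move=> /(lipschitz_ge0 regd)[k k0 uk].
apply: (measurability _ (RGenOInfty.measurableE R)) => _ [_ [a ->] <-].
apply: sub_sigma_algebra; rewrite setTI openE => x /=.
rewrite in_itv/= andbT => ax.
have k10 : 0 < k + 1 by rewrite ltr_wpDl.
have e0 : 0 < (u x - a) / (k + 1) by rewrite divr_gt0 ?subr_gt0.
apply: filterS (nbhs_open_ball regd x e0) => y xy.
rewrite /preimage/= in_itv/= andbT -subr_gt0.
have := uk x y; rewrite ler_norml => /andP[_ uxy].
have : k * d x y < u x - a.
  apply: (@le_lt_trans _ _ ((k + 1) * d x y)).
    by rewrite ler_wpM2r ?lerDl ?(dist_ge0 regd).
  by move: xy; rewrite /open_ball/= ltr_pdivlMr// mulrC.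
lra.
Qed.

Lemma lipschitz_integrable (mu : probability (borel C) R) u :
  lipschitz_fun d u -> mu.-integrable setT (EFin \o (u : borel C -> R)).
Proof.
move=> lipu.
have muT : (mu setT < +oo)%E by rewrite probability_setT ltry.
apply: measurable_bounded_integrable => //; first exact: lipschitz_measurable.
have [M uM] := lipschitz_bounded regd ultrad compactC lipu.
exists M; split; first exact: num_real.
by move=> M' MM' x _; exact: le_trans (uM x) (ltW MM').
Qed.

Lemma integral_mean (mu : probability (borel C) R) :
  is_mean d (fun u => \int[mu]_x u x).
Proof.
have int := lipschitz_integrable mu.
have Rcst (a : R) : \int[mu]_x a = a.
  by rewrite Rintegral_cst// [X in fine X](probability_setT mu) mulr1.
split.
- by move=> u v lu lv; rewrite RintegralD//; exact: int.
- by move=> a u lu; rewrite RintegralZl//; exact: int.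
- move=> u M lu uM; have lM := lipschitz_cst d M.
  apply: le_trans (le_normr_Rintegral measurableT (int u lu)) _.
  have -> : M = \int[mu]_x M by rewrite Rcst.
  apply: le_Rintegral => //; first exact: (integrable_abse (int u lu)).
  exact: (int (cst M) lM).
- by rewrite Rcst.
Qed.

(** The extension lives on the sigma-algebra generated by the uniformly clopen
    sets; pushing it forward along the identity restricts it to Borel sets. *)
Lemma mean_representation L : is_mean d L -> exists mu : probability (borel C) R,
  forall u, lipschitz_fun d u -> L u = \int[mu]_x u x.
Proof.
move=> meanL; have [m mE] := mean_measure meanL.
pose S := g_sigma_algebraType (@measurable _ (clopen_space d)).
have idm : measurable_fun setT (id : S -> borel C).
  by move=> _ A /borel_clopen; rewrite setTI.
pose m1 : {measure set S -> \bar R} := measure_extension m.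
pose mu0 : {measure set (borel C) -> \bar R} := pushforward m1 (id : S -> borel C).
pose m2 := mu0 idm.
have m2E A : uniformly_clopen d A -> m2 A = (L (\1_A))%:E.
  move=> cA; rewrite /m2/= /mu0/= /pushforward /m1/= /measure_extension.
  by rewrite measurable_mu_extE// mE.
have m2T : m2 setT = 1%E.
  rewrite m2E; last exact: uniformly_clopenT.
  by rewrite indicT; have [_ _ _ ->] := meanL.
(* The mass is 1 already: normalizing leaves the measure unchanged and packs it
   as a probability. *)
pose mu : probability (borel C) R := mnormalize m2 (\d_(point : borel C)).
have muE A : mu A = m2 A.
  by rewrite /mu/= /mnormalize m2T onee_eq0/= invr1 mule1.
exists mu; apply: (mean_unique regd ultrad compactC meanL (integral_mean mu)).
move=> A cA.
have mA : measurable (A : set (borel C)).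
  by apply: sub_sigma_algebra; exact: (uniformly_clopen_open regd cA).
by rewrite /Rintegral /= integral_indic// setIT [X in fine X]muE m2E.
Qed.

End representation.

(** * Unordered sums of real families *)

Section unordered_sums.
Context {R : realType} {I : choiceType}.
Implicit Types (u v w : I -> R).

Definition abs_summable u := summable [set: I] (EFin \o u).

Local Notation nnsum u := (\esum_(i in [set: I]) (u i)%:E)%E.

Lemma nnsum_fin_num u : (forall i, 0 <= u i) -> abs_summable u ->
  nnsum u \is a fin_num.
Proof.
move=> u0; rewrite /abs_summable summableE (eq_esum (b := fun i => (u i)%:E))//.
by move=> i _; rewrite /= ger0_norm.
Qed.

Lemma abs_summable_le u w : (forall i, `|u i| <= `|w i|) -> abs_summable w ->
  abs_summable u.
Proof. by move=> uw; apply: le_lt_trans; apply: le_esum => i _ /=; rewrite lee_fin. Qed.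

Lemma abs_summable_pos u : abs_summable u -> abs_summable (u^\+)%R.
Proof.
apply: abs_summable_le => i; rewrite ger0_norm ?funrpos_ge0//.
by rewrite -[leRHS]/((Num.norm \o u) i) -funrposDneg lerDl funrneg_ge0.
Qed.

Lemma abs_summable_neg u : abs_summable u -> abs_summable (u^\-)%R.
Proof.
apply: abs_summable_le => i; rewrite ger0_norm ?funrneg_ge0//.
by rewrite -[leRHS]/((Num.norm \o u) i) -funrposDneg lerDr funrpos_ge0.
Qed.

Lemma abs_summableD u v : abs_summable u -> abs_summable v ->
  abs_summable (u \+ v).
Proof. exact: summableD. Qed.

(** Any decomposition into nonnegative families computes the sum, not only the
    one into positive and negative parts. Additivity needs this, since the
    positive part of a sum is not the sum of the positive parts. *)
Lemma rsum_nnegB u v : (forall i, 0 <= u i) -> (forall i, 0 <= v i) ->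
  abs_summable u -> abs_summable v ->
  rsum (u \- v) = fine (nnsum u) - fine (nnsum v).
Proof.
move=> u0 v0 su sv; rewrite -fineB; [|exact: nnsum_fin_num|exact: nnsum_fin_num].
rewrite /rsum -(esumB su sv) => [|i _|i _]; rewrite ?lee_fin//.
Qed.

Lemma rsum_nneg u : (forall i, 0 <= u i) -> abs_summable u ->
  rsum u = fine (nnsum u).
Proof.
move=> u0 su; rewrite [in LHS](_ : u = u \- cst 0); last first.
  by apply/funext => i /=; rewrite subr0.
have s0 : abs_summable (cst 0).
  by apply: abs_summable_le su => i; rewrite normr0 normr_ge0.
by rewrite rsum_nnegB// (esum1 (fun _ _ => erefl))/= subr0.
Qed.

Lemma rsum0 : rsum (fun _ : I => 0 : R) = 0.
Proof.
rewrite rsum_nneg// ?esum1//.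
by rewrite /abs_summable /summable esum1 ?ltry// => i _ /=; rewrite normr0.
Qed.

Lemma rsum_ge0 u : (forall i, 0 <= u i) -> abs_summable u -> 0 <= rsum u.
Proof.
move=> u0 su; rewrite rsum_nneg// fine_ge0// esum_ge0// => i _.
by rewrite lee_fin.
Qed.

Lemma rsum_posneg u : abs_summable u ->
  rsum u = fine (nnsum (u^\+)%R) - fine (nnsum (u^\-)%R).
Proof.
move=> su; rewrite -rsum_nnegB; [|exact: funrpos_ge0|exact: funrneg_ge0
  |exact: abs_summable_pos|exact: abs_summable_neg].
by congr rsum; rewrite -[LHS]funrposBneg.
Qed.

Lemma fine_nnsumD u v : (forall i, 0 <= u i) -> (forall i, 0 <= v i) ->
  abs_summable u -> abs_summable v ->
  fine (nnsum (u \+ v)) = fine (nnsum u) + fine (nnsum v).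
Proof.
move=> u0 v0 su sv; rewrite -fineD; [|exact: nnsum_fin_num|exact: nnsum_fin_num].
by rewrite -esumD => // i _; rewrite lee_fin.
Qed.

Lemma rsumD u v : abs_summable u -> abs_summable v ->
  rsum (u \+ v) = rsum u + rsum v.
Proof.
move=> su sv; rewrite (rsum_posneg su) (rsum_posneg sv).
have [su' sv'] := (abs_summable_neg su, abs_summable_neg sv).
have [{}su {}sv] := (abs_summable_pos su, abs_summable_pos sv).
have -> : u \+ v = (u^\+ \+ v^\+)%R \- (u^\- \+ v^\-)%R.
  rewrite -{1}(funrposBneg u) -{1}(funrposBneg v); apply/funext => i /=.
  by rewrite !fctE; ring.
rewrite rsum_nnegB; [|by move=> i; rewrite addr_ge0..
  |exact: abs_summableD|exact: abs_summableD].
by rewrite !fine_nnsumD// opprD addrACA.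
Qed.

Lemma nnsumZ (a : R) u : 0 < a -> (forall i, 0 <= u i) ->
  (nnsum (a \*o u) = a%:E * nnsum u)%E.
Proof.
have le_nnsumZ (b : R) v : 0 < b -> (forall i, 0 <= v i) ->
    (nnsum (b \*o v) <= b%:E * nnsum v)%E.
  move=> b0 v0; apply: ge_ereal_sup => _ [F [finF _] <-].
  rewrite (eq_fsbigr (fun i => b%:E * (v i)%:E)%E) => [|i _]; last by rewrite -EFinM.
  rewrite -ge0_mule_fsumr; last by move=> i; rewrite lee_fin.
  by rewrite lee_pmul2l//; apply: ereal_sup_ubound; exists F.
move=> a0 u0; apply/eqP; rewrite eq_le le_nnsumZ//=.
rewrite -lee_pdivlMl//.
have {1}-> : u = a^-1 \*o (a \*o u).
  by apply/funext => i /=; rewrite mulKf ?gt_eqF.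
by apply: le_nnsumZ; rewrite ?invr_gt0// => i /=; rewrite mulr_ge0// ltW.
Qed.

Lemma abs_summableZ (a : R) u : abs_summable u -> abs_summable (a \*o u).
Proof.
move=> su; have [->|a0] := eqVneq a 0.
  by apply: abs_summable_le su => i; rewrite /= mul0r normr0.
rewrite /abs_summable /summable (_ : \esum_(i in _) _ =
  nnsum (`|a| \*o (fun i => `|u i|)))%E; last first.
  by apply: eq_esum => i _ /=; rewrite normrM.
rewrite nnsumZ ?normr_gt0//.
exact: lte_mul_pinfty.
Qed.

Lemma rsumN u : abs_summable u -> rsum (-1 \*o u) = - rsum u.
Proof.
move=> su; have sNu := abs_summableZ (-1) su.
apply/eqP; rewrite -addr_eq0 -rsumD//.
rewrite -rsum0; apply/eqP; congr rsum; apply/funext => i /=.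
by rewrite mulN1r addNr.
Qed.

Lemma rsumZ (a : R) u : abs_summable u -> rsum (a \*o u) = a * rsum u.
Proof.
have rsumZpos (b : R) v : 0 < b -> abs_summable v -> rsum (b \*o v) = b * rsum v.
  move=> b0 sv; rewrite !rsum_posneg//; last exact: abs_summableZ.
  rewrite ge0_funrposM ?ltW// ge0_funrnegM ?ltW//.
  by rewrite !nnsumZ// !fineM// ?mulrBr//; apply: nnsum_fin_num => //;
    [exact: abs_summable_neg|exact: abs_summable_pos].
move=> su; have [a0|a0|->] := ltgtP a 0.
- rewrite -[a]opprK mulNr -rsumZpos ?oppr_gt0// -rsumN; last exact: abs_summableZ.
  by congr rsum; apply/funext => i /=; rewrite mulN1r !mulNr opprK.
- exact: rsumZpos.
by rewrite mul0r -[RHS]rsum0; congr rsum; apply/funext => i /=; rewrite mul0r.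
Qed.

Lemma rsumB u v : abs_summable u -> abs_summable v ->
  rsum (u \- v) = rsum u - rsum v.
Proof.
move=> su sv; rewrite -rsumN// -rsumD//; last exact: abs_summableZ.
by congr rsum; apply/funext => i /=; rewrite mulN1r.
Qed.

Lemma rsum_le u w : (forall i, `|u i| <= w i) -> abs_summable w ->
  `|rsum u| <= rsum w.
Proof.
move=> uw sw; have su : abs_summable u.
  by apply: abs_summable_le sw => i; exact: le_trans (uw i) (ler_norm _).
have le_rsum v : abs_summable v -> (forall i, v i <= w i) -> rsum v <= rsum w.
  move=> sv vw; rewrite -subr_ge0 -rsumB//; apply: rsum_ge0 => [i /=|].
    by rewrite subr_ge0.
  by apply: abs_summableD => //; move: sv; rewrite /abs_summable summableN.
rewrite ler_norml lerNl -rsumN// !le_rsum//.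
- by move=> i; exact: le_trans (ler_norm _) (uw i).
- exact: abs_summableZ.
- by move=> i; rewrite /= mulN1r (le_trans (ler_norm _))// normrN.
Qed.

End unordered_sums.

(** * Real and imaginary parts of limits *)

Section complex_limits.
Context {R : realType} {T : Type}.
Implicit Types (F : set_system T) (f : T -> R[i]^o) (l : R[i]^o).

Lemma normc_ge_Im (z : R[i]) : `|complex.Im z|%:C <= `|z|.
Proof.
rewrite -normrN -ReiNIm (le_trans (normc_ge_Re _))// normrM.
by rewrite [X in _ * X]normc_def/= expr0n/= add0r expr1n sqrtr1 mulr1.
Qed.

Lemma cvg_Re F {FF : Filter F} f l :
  f @ F --> l -> complex.Re (f x) @[x --> F] --> complex.Re l.
Proof.
move=> /cvgrPdist_lt fl; apply/cvgrPdist_lt => e e0.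
have := fl e%:C; rewrite ltcR => /(_ e0); apply: filterS => x.
rewrite -ltcR; apply: le_lt_trans.
by rewrite -raddfB; exact: normc_ge_Re.
Qed.

Lemma cvg_Im F {FF : Filter F} f l :
  f @ F --> l -> complex.Im (f x) @[x --> F] --> complex.Im l.
Proof.
move=> /cvgrPdist_lt fl; apply/cvgrPdist_lt => e e0.
have := fl e%:C; rewrite ltcR => /(_ e0); apply: filterS => x.
rewrite -ltcR; apply: le_lt_trans.
by rewrite -raddfB; exact: normc_ge_Im.
Qed.

End complex_limits.

(** * Weighted sums over the vertices *)

Section diameters.
Context {R : realType} {C : ptopologicalType} (d : C -> C -> R).

Lemma le_diam (M : R) (A : set C) x y : (forall x y, d x y <= M) ->
  A x -> A y -> d x y <= diam d A.
Proof.
move=> dM Ax Ay; apply: ub_le_sup; last by exists x => //; exists y.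
by exists M => _ [x' _ [y' _ <-]].
Qed.

Lemma diam_le (M : R) (A : set C) x : (forall x y, d x y <= M) -> A x ->
  diam d A <= M.
Proof.
move=> dM Ax; apply: ge_sup; first by exists (d x x), x => //; exists x.
by move=> _ [x' _ [y' _ <-]].
Qed.

End diameters.

Section zeta_sums.
Context {R : realType} {C : ptopologicalType} (d : C -> C -> R).
Local Notation V := (vertices d).
Implicit Types (tau : V -> C * C) (s : R) (u : C -> R) (f : C -> R[i]).

Definition weight s (b : V * 'I_2) : R := vdiam b.1 `^ s.

Definition zeta s : R := rsum (weight s).

Definition chosen_point tau (b : V * 'I_2) : C :=
  if b.2 == 0 then (tau b.1).1 else (tau b.1).2.

Definition zeta_sum tau u s : R :=
  rsum (fun b => weight s b * u (chosen_point tau b)).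

Lemma mulcRl (a : R) (z : R[i]) : a%:C * z = (a * complex.Re z) +i* (a * complex.Im z).
Proof. by case: z => x y; simpc. Qed.

Lemma trace_zeta s : trace (@absDirac_powN _ _ d s) = (zeta s)%:C.
Proof.
rewrite /trace /csum (_ : diag_coef _ = fun b => (weight s b)%:C); last first.
  by apply/funext => b; rewrite diag_coef_absDirac_powN.
by rewrite /= rsum0.
Qed.

Lemma zetaE s : zeta s = fine (\esum_(b in [set: V * 'I_2]) (weight s b)%:E).
Proof.
have := trace_zeta s; rewrite trace_absDirac_powN -esum_diam_pow.
by move=> /(congr1 (@complex.Re _)) /= <-.
Qed.

(** A divergent sum of nonnegative terms has the default value 0, so a nonzero
    value of [zeta] certifies convergence. *)
Lemma weight_summable s : zeta s != 0 -> abs_summable (weight s).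
Proof.
rewrite zetaE /abs_summable /summable => z0.
rewrite (eq_esum (a := fun b => `|(EFin \o weight s) b|%E)
  (b := fun b => (weight s b)%:E)); last first.
  by move=> b _ /=; rewrite ger0_norm// powR_ge0.
by move: z0; case: (esum _ _) => [r _|/=|/=]; rewrite ?ltry ?eqxx.
Qed.

Lemma Re_zeta_ratio tau f s :
  complex.Re (zeta_ratio tau f s) = zeta_sum tau (@complex.Re R \o f) s / zeta s.
Proof.
rewrite /zeta_ratio trace_zeta -fmorphV/= /trace /csum/= mulr0 subr0.
congr (rsum _ / _); apply/funext => b.
by rewrite diag_coef_absDirac_powN_pi_rep mulcRl /chosen_point; case: ifP.
Qed.

Lemma Im_zeta_ratio tau f s :
  complex.Im (zeta_ratio tau f s) = zeta_sum tau (@complex.Im R \o f) s / zeta s.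
Proof.
rewrite /zeta_ratio trace_zeta -fmorphV/= /trace /csum/= mulr0 add0r.
congr (rsum _ / _); apply/funext => b.
by rewrite diag_coef_absDirac_powN_pi_rep mulcRl /chosen_point; case: ifP.
Qed.

Lemma lipschitz_Re f : Lipschitz d f -> lipschitz_fun d (@complex.Re R \o f).
Proof.
move=> [k fk]; exists k => x y /=; rewrite -lecR -raddfB.
exact: le_trans (normc_ge_Re _) (fk x y).
Qed.

Lemma lipschitz_Im f : Lipschitz d f -> lipschitz_fun d (@complex.Im R \o f).
Proof.
move=> [k fk]; exists k => x y /=; rewrite -lecR -raddfB.
exact: le_trans (normc_ge_Im _) (fk x y).
Qed.

Lemma Lipschitz_real u : lipschitz_fun d u -> Lipschitz d (fun x => (u x)%:C).
Proof.
move=> [k uk]; exists k => x y; rewrite -rmorphB/=.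
by rewrite normc_def/= expr0n/= addr0 sqrtr_sqr lecR.
Qed.

Section bounded_functions.
Variable s : R.
Hypothesis sum_s : abs_summable (weight s).

Lemma weighted_summable (M : R) (v : V * 'I_2 -> R) : (forall b, `|v b| <= M) ->
  abs_summable (fun b => weight s b * v b).
Proof.
move=> vM; apply: abs_summable_le (abs_summableZ M sum_s) => b /=.
rewrite mulrC !normrM ler_wpM2r// (le_trans (vM b))//; exact: ler_norm.
Qed.

Lemma zeta_sumD (M N : R) tau u v :
  (forall x, `|u x| <= M) -> (forall x, `|v x| <= N) ->
  zeta_sum tau (u \+ v) s = zeta_sum tau u s + zeta_sum tau v s.
Proof.
move=> uM vN; rewrite /zeta_sum -rsumD.
- by congr rsum; apply/funext => b /=; rewrite mulrDr.
- by apply: (@weighted_summable M) => b.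
- by apply: (@weighted_summable N) => b.
Qed.

Lemma zeta_sumZ (a M : R) tau u : (forall x, `|u x| <= M) ->
  zeta_sum tau (a \*o u) s = a * zeta_sum tau u s.
Proof.
move=> uM; rewrite /zeta_sum -rsumZ; last by apply: (@weighted_summable M) => b.
by congr rsum; apply/funext => b /=; rewrite mulrCA.
Qed.

Lemma zeta_sum_le (M : R) tau u : (forall x, `|u x| <= M) ->
  `|zeta_sum tau u s| <= M * zeta s.
Proof.
move=> uM; rewrite /zeta -rsumZ//; apply: rsum_le; last exact: abs_summableZ.
by move=> b /=; rewrite normrM mulrC ler_pM// ger0_norm// powR_ge0.
Qed.

End bounded_functions.

Lemma zeta_sum1 tau s : zeta_sum tau (cst 1) s = zeta s.
Proof. by congr rsum; apply/funext => b; rewrite /= mulr1. Qed.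

(** Since [a * a^s = a^(1 + s - t) * a^t], the extra factor [a] is traded for a
    change of exponent from [s] to [t], at a cost bounded uniformly in [s]. *)
Lemma le_powR_shift (M a s t : R) : 0 <= a <= M -> 0 <= 1 + s - t <= 2 ->
  a `^ s * a <= (1 + M) ^+ 2 * a `^ t.
Proof.
move=> /andP[a0 aM] /andP[e0 e2].
have [->|an0] := eqVneq a 0; first by rewrite mulr0 mulr_ge0// ?exprn_ge0
  ?powR_ge0// addr_ge0// (le_trans a0).
have -> : a `^ s * a = a `^ (1 + s - t) * a `^ t.
  rewrite -[X in _ * X](powRr1 a0) -!powRD ?an0 ?implybT//; congr (_ `^ _); ring.
rewrite ler_wpM2r ?powR_ge0//.
apply: (@le_trans _ _ ((1 + M) `^ (1 + s - t))).
  by apply: ge0_ler_powR; rewrite ?nnegrE//; lra.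
by rewrite -powR_mulrn; [apply: ler_powR => //|]; lra.
Qed.

(** The points that [tau] and [tau'] choose in a vertex are at most its diameter
    apart, so the terms differ by at most [k] times the weight of exponent
    [s + 1]. Bounding by the weight of a fixed exponent [t] gives an estimate
    that does not depend on [s]. *)
Lemma zeta_sum_choice (M N k t s : R) tau tau' u :
  (forall x y, 0 <= d x y <= M) -> (forall x, `|u x| <= N) ->
  0 <= k -> (forall x y, `|u x - u y| <= k * d x y) ->
  is_choice_function tau -> is_choice_function tau' ->
  abs_summable (weight s) -> abs_summable (weight t) ->
  0 <= 1 + s - t <= 2 ->
  `|zeta_sum tau u s - zeta_sum tau' u s| <= k * (1 + M) ^+ 2 * zeta t.
Proof.
move=> dM uN k0 uk ctau ctau' ss st est.
have mem sigma b : is_choice_function sigma -> val b.1 (chosen_point sigma b).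
  by move=> /(_ b.1)[]; rewrite /chosen_point; case: ifP.
rewrite /zeta_sum -rsumB.
- rewrite /zeta -rsumZ//; apply: rsum_le; last exact: abs_summableZ.
  move=> b /=; rewrite -mulrBr normrM (ger0_norm (powR_ge0 _ _)).
  apply: le_trans (ler_wpM2l (powR_ge0 _ _) (uk _ _)) _.
  rewrite mulrCA -mulrA ler_wpM2l//.
  have inb := mem _ b ctau; have inb' := mem _ b ctau'.
  have dleM x y : d x y <= M by have /andP[] := dM x y.
  apply: (@le_trans _ _ (vdiam b.1 `^ s * vdiam b.1)).
    by rewrite ler_wpM2l ?powR_ge0//; exact: le_diam dleM inb inb'.
  apply: le_powR_shift est; rewrite (diam_le dleM inb) andbT.
  apply: le_trans (le_diam dleM inb inb').
  by have /andP[] := dM (chosen_point tau b) (chosen_point tau' b).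
- by apply: (@weighted_summable _ ss N) => b.
- by apply: (@weighted_summable _ ss N) => b.
Qed.

End zeta_sums.

(** * The limit functional *)

Section zeta_means.
Context {R : realType} {C : ptopologicalType} (d : C -> C -> R).
Hypothesis regd : regular_metric d.
Hypothesis ultrad : is_ultrametric d.
Hypothesis compactC : compact [set: C].
Hypothesis zreg : zeta_regular d.
Local Notation V := (vertices d).
Local Notation s0 := (s0 d).
Implicit Types (tau : V -> C * C) (s : R) (u : C -> R) (f : C -> R[i]).

Lemma cvg_residue : exists2 l : R, 0 < l &
  (s - s0) * zeta d s @[s --> s0^'+] --> l.
Proof.
have [_ [l l0 sl] _] := zreg.
exists (complex.Re l); first by have := l0; rewrite ltcE => /andP[].
by have := cvg_Re sl; under eq_fun do rewrite trace_zeta mulcRl; apply.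
Qed.

Lemma near_zeta_gt0 : \forall s \near s0^'+, 0 < zeta d s.
Proof.
have [l l0 sl] := cvg_residue; near=> s.
rewrite -(@pmulr_rgt0 _ (s - s0)); last first.
  by rewrite subr_gt0; near: s; exact: nbhs_right_gt.
by near: s; apply: (cvgr_gt _ sl).
Unshelve. all: by end_near. Qed.

(** Convergence of the series to the right of [s0] is read off from the positive
    residue rather than from the definition of the abscissa. *)
Lemma near_summable : \forall s \near s0^'+, abs_summable (weight (d := d) s).
Proof.
by apply: filterS near_zeta_gt0 => s z0; apply: weight_summable; rewrite gt_eqF.
Qed.

(** Near [s0] the inverse of [zeta] behaves like [(s - s0) / l], with [l] the
    residue. *)
Lemma cvg_zetaV : (zeta d s)^-1 @[s --> s0^'+] --> (0 : R).
Proof.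
have [l l0 sl] := cvg_residue.
have -> : (0 : R) = (s0 - s0) * l^-1 by rewrite subrr mul0r.
have : (s - s0) * ((s - s0) * zeta d s)^-1 @[s --> s0^'+] --> (s0 - s0) * l^-1.
  apply: cvgM; last by apply: cvgV => //; rewrite gt_eqF.
  apply: cvgB; last exact: cvg_cst.
  exact/cvg_at_right_filter/cvg_id.
apply: cvg_trans; apply: near_eq_cvg; near=> s.
have : s - s0 != 0.
  by rewrite subr_eq0 gt_eqF//; near: s; exact: nbhs_right_gt.
by move=> ss0; rewrite invfM mulrA divff// mul1r.
Unshelve. all: by end_near. Qed.

Definition real_mean tau u : R := lim (zeta_sum tau u s / zeta d s @[s --> s0^'+]).

Lemma cvg_real_mean tau u : is_choice_function tau -> lipschitz_fun d u ->
  zeta_sum tau u s / zeta d s @[s --> s0^'+] --> real_mean tau u.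
Proof.
move=> ctau lipu; have [_ _ /(_ _ tau (Lipschitz_real lipu) ctau)] := zreg.
move=> /cvg_ex[l /cvg_Re]; under eq_fun do rewrite Re_zeta_ratio.
by move=> ul; apply/cvg_ex; eexists; exact: ul.
Qed.

Lemma zeta_mean_real tau f : is_choice_function tau -> Lipschitz d f ->
  zeta_mean tau f =
    real_mean tau (@complex.Re R \o f) +i* real_mean tau (@complex.Im R \o f).
Proof.
move=> ctau lipf; have [_ _ /(_ _ _ lipf ctau) zf] := zreg.
have Re_f : zeta_sum tau (@complex.Re R \o f) s / zeta d s @[s --> s0^'+] -->
    complex.Re (zeta_mean tau f).
  by have := cvg_Re zf; under eq_fun do rewrite Re_zeta_ratio; apply.
have Im_f : zeta_sum tau (@complex.Im R \o f) s / zeta d s @[s --> s0^'+] -->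
    complex.Im (zeta_mean tau f).
  by have := cvg_Im zf; under eq_fun do rewrite Im_zeta_ratio; apply.
rewrite /real_mean (cvg_lim _ Re_f)// (cvg_lim _ Im_f)//.
by case: (zeta_mean tau f).
Qed.

Lemma real_mean_is_mean tau : is_choice_function tau -> is_mean d (real_mean tau).
Proof.
move=> ctau; have cvgu u := @cvg_real_mean tau u ctau.
have bounded := lipschitz_bounded regd ultrad compactC.
split=> [u v lu lv|a u lu|u M lu uM|].
- have [M uM] := bounded _ lu; have [N vN] := bounded _ lv.
  have uvL : zeta_sum tau u s / zeta d s + zeta_sum tau v s / zeta d s
      @[s --> s0^'+] --> real_mean tau u + real_mean tau v.
    by apply: cvgD; exact: cvgu.
  apply: cvg_lim => //; move: uvL.
  apply: cvg_trans; apply: near_eq_cvg; near=> s.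
  have ss : abs_summable (weight (d := d) s) by near: s; exact: near_summable.
  by rewrite (zeta_sumD ss _ uM vN) mulrDl.
- have [M uM] := bounded _ lu.
  have aL : a * (zeta_sum tau u s / zeta d s) @[s --> s0^'+] --> a * real_mean tau u.
    by apply: cvgM; [exact: cvg_cst|exact: cvgu].
  apply: cvg_lim => //; move: aL.
  apply: cvg_trans; apply: near_eq_cvg; near=> s.
  have ss : abs_summable (weight (d := d) s) by near: s; exact: near_summable.
  by rewrite (zeta_sumZ ss _ _ uM) mulrA.
- apply: (cvgr_to_le (cvg_norm (cvgu _ lu))); near=> s.
  have z0 : 0 < zeta d s by near: s; exact: near_zeta_gt0.
  rewrite normrM normfV (gtr0_norm z0) ler_pdivrMr//.
  apply: zeta_sum_le => //; near: s; exact: near_summable.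
- apply: cvg_lim => //; apply: cvg_near_cst; near=> s.
  by rewrite zeta_sum1 divff// gt_eqF//; near: s; exact: near_zeta_gt0.
Unshelve. all: by end_near. Qed.

(** The difference of the two sums is bounded independently of [s], and [zeta]
    tends to infinity. The exponent [t] of the bound is taken in
    [(s0, s0 + 1)], so that [t <= s + 1 <= t + 2] for all [s] near [s0]. *)
Lemma real_mean_choice tau tau' u : is_choice_function tau ->
  is_choice_function tau' -> lipschitz_fun d u ->
  real_mean tau u = real_mean tau' u.
Proof.
move=> ctau ctau' lipu.
have [N uN] := lipschitz_bounded regd ultrad compactC lipu.
have [k k0 uk] := lipschitz_ge0 regd lipu.
have [M _ dM] := bounded_dist regd ultrad compactC.
have [t [st [s0t t1]]] : exists t, abs_summable (weight (d := d) t) /\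
    s0 < t /\ t < s0 + 1.
  apply: (@filter_ex _ s0^'+); near=> t.
  split; first by near: t; exact: near_summable.
  split; near: t; first exact: nbhs_right_gt.
  by apply: nbhs_right_lt; rewrite ltrDl.
apply/eqP; rewrite -subr_eq0; apply/eqP.
have diff : zeta_sum tau u s / zeta d s - zeta_sum tau' u s / zeta d s
    @[s --> s0^'+] --> real_mean tau u - real_mean tau' u.
  by apply: cvgB; exact: cvg_real_mean.
apply: (cvg_unique _ diff) => //; apply/norm_cvg0P.
pose B := k * (1 + M) ^+ 2 * zeta d t.
have B0 : B * (zeta d s)^-1 @[s --> s0^'+] --> (0 : R).
  rewrite -[X in _ --> X](mulr0 B).
  by apply: cvgM; [exact: cvg_cst|exact: cvg_zetaV].
apply: (squeeze_cvgr _ (cvg_cst 0) B0); near=> s.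
have z0 : 0 < zeta d s by near: s; exact: near_zeta_gt0.
rewrite normr_ge0/= -mulrBl normrM normfV (gtr0_norm z0).
rewrite ler_wpM2r ?invr_ge0 ?(ltW z0)//.
apply: (zeta_sum_choice _ uN) => //.
- by move=> x y; rewrite (dist_ge0 regd) dM.
- near: s; exact: near_summable.
have : s0 < s by near: s; exact: nbhs_right_gt.
have : s < s0 + 1 by near: s; apply: nbhs_right_lt; rewrite ltrDl.
by move=> ? ?; apply/andP; split; lra.
Unshelve. all: by end_near. Qed.

Lemma zeta_mean_choice tau tau' f : Lipschitz d f ->
  is_choice_function tau -> is_choice_function tau' ->
  zeta_mean tau f = zeta_mean tau' f.
Proof.
move=> lipf ctau ctau'; rewrite !zeta_mean_real//.
rewrite (real_mean_choice ctau ctau' (lipschitz_Re lipf)).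
by rewrite (real_mean_choice ctau ctau' (lipschitz_Im lipf)).
Qed.

End zeta_means.

Theorem theorem3 (R : realType) (C : ptopologicalType) (d : C -> C -> R)
    (cantorC : is_cantor_set R C) (regd : regular_metric d)
    (ultrad : is_ultrametric d) (zreg : zeta_regular d) :
  (forall (f : C -> R[i]) (tau tau' : vertices d -> C * C),
     Lipschitz d f -> is_choice_function tau -> is_choice_function tau' ->
     zeta_mean tau f = zeta_mean tau' f) /\
  (exists mu : probability (borel C) R,
     forall (f : C -> R[i]) (tau : vertices d -> C * C),
       Lipschitz d f -> is_choice_function tau ->
       cintegrable mu f /\ zeta_mean tau f = cintegral mu f).
Proof.
have [_ _ compactC _ _] := cantorC.
have indep := zeta_mean_choice regd ultrad compactC zreg.
split=> [f tau tau'|]; first exact: indep.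
(* A choice function is needed to define the functional. If there were none, the
   claim about the measure would hold vacuously, for any probability. *)
have [[tau0 ctau0]|no_choice] :=
  pselect (exists tau : vertices d -> C * C, is_choice_function tau); last first.
  exists (\d_(point : borel C)) => f tau _ ctau.
  by case: no_choice; exists tau.
have [mu muE] := mean_representation regd ultrad compactC
  (real_mean_is_mean regd ultrad compactC zreg ctau0).
exists mu => f tau lipf ctau.
have [lipRe lipIm] := (lipschitz_Re lipf, lipschitz_Im lipf).
split.
  by split; [exact: (lipschitz_integrable regd ultrad compactC mu lipRe)
            |exact: (lipschitz_integrable regd ultrad compactC mu lipIm)].
by rewrite (indep _ tau0)// zeta_mean_real// !muE.
Qed.
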